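(* Let $r\ge2$, let $n\ge1$ and let $\mathfrak t=\theta_1,\dots,\theta_n$ be a cyclically admissible sequence of standard Nielsen automorphisms $\theta_i=[x_i\mapsto y_ix_i]$ of $F_r$. Then $g_{\mathfrak t}=g_{\theta_n}\circ\dots\circ g_{\theta_1}:R_r\to R_r$ is a train track map with exactly one nondegenerate illegal turn, namely the turn $\{x_1,y_1\}$.
   Context: $F_r$ is the free group with fixed free basis $A=\{a_1,\dots,a_r\}$. A standard Nielsen automorphism $\theta=[x\mapsto yx]$ (where $x,y\in A^{\pm1}$, $y\ne x^{\pm1}$) is the automorphism with $\theta(x)=yx$ and $\theta(z)=z$ for $z\in A^{\pm1}\setminus\{x,x^{-1}\}$. An ordered pair $([x\mapsto yx],[x'\mapsto y'x'])$ is admissible if either $x'=x$ and $y'\ne y^{-1}$, or $y'=x$ and $x'\ne y^{-1}$. A sequence $\theta_1,\dots,\theta_n$ is admissible if $(\theta_i,\theta_{i+1})$ is admissible for all $1\le i<n$, and cyclically admissible if also $(\theta_n,\theta_1)$ is admissible. The rose $R_r$ is the wedge of $r$ loop-edges labelled $a_1,\dots,a_r$ at a single vertex $v$; its oriented edges, equivalently the directions at $v$, are identified with $A^{\pm1}$ (inverse = reversed orientation). A graph map $f:R_r\to R_r$ is a continuous map fixing $v$ and sending each oriented edge $e$ to an edge-path $f(e)=e_1\dots e_k$, $k\ge1$ (affinely on the subsegments mapped to the $e_i$). For $\theta=[x\mapsto yx]$, $g_\theta:R_r\to R_r$ is the graph map sending the edge $x$ to the edge-path $yx$ and every edge $z\ne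 x^{\pm1}$ to $z$. The derivative map is $Df(e)=e_1$. A turn is an unordered pair of oriented edges of $R_r$; it is degenerate if the two coincide. A nondegenerate turn $\{e,e'\}$ is legal for $f$ if $\{(Df)^k(e),(Df)^k(e')\}$ is nondegenerate for all $k\ge1$; a turn is illegal if it is not legal. A graph map $f:R_r\to R_r$ is a train track map if it is a homotopy equivalence and for all $k\ge1$ and every edge $e$ the edge-path $f^k(e)$ is reduced (contains no subpath $e'e'^{-1}$). *)

(* Defs.v *)
From HB Require Import structures.
From mathcomp Require Import all_boot all_order all_algebra.
From mathcomp Require Import all_classical all_reals all_analysis.
From mathcomp Require Import homotopy.

Set Implicit Arguments.
Unset Strict Implicit.
Unset Printing Implicit Defensive.

Import Order.TTheory GRing.Theory Num.Theory.
Import numFieldNormedType.Exports.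

Local Open Scope classical_set_scope.
Local Open Scope ring_scope.
Local Open Scope quotient_scope.

(* A^{+-1}: [(i, false)] is the basis element a_i of F_r and [(i, true)] its
   inverse; these are also the oriented edges of the rose. *)
Notation letter r := ('I_r * bool)%type.

Definition linv (r : nat) (e : letter r) : letter r := (e.1, ~~ e.2).

Definition reduced (r : nat) (p : seq (letter r)) : bool :=
  sorted (fun e e' => e' != linv e) p.

(* The symbol [x |-> yx]. The pair (x, y) is determined by the automorphism,
   and the automorphism by its values on letters, given by [nielsen_word]. *)
Record nielsen (r : nat) : Type := Nielsen {
  nx : letter r;
  ny : letter r;
  nielsen_neq : ny != nx;
  nielsen_neqV : ny != linv nx }.

Definition nielsen_word (r : nat) (th : nielsen r) (z : letter r) :
    seq (letter r) :=
  if z == nx th then [:: ny th; nx th]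
  else if z == linv (nx th) then [:: linv (nx th); linv (ny th)]
  else [:: z].

Definition admissible (r : nat) (th th' : nielsen r) : bool :=
  ((nx th' == nx th) && (ny th' != linv (ny th))) ||
  ((ny th' == nx th) && (nx th' != linv (ny th))).

(* [cycle] also compares the last element with the first one. *)
Definition cyclically_admissible (r : nat) (ths : seq (nielsen r)) : bool :=
  cycle (@admissible r) ths.

Notation uinterval R := (set_type (`[0, 1]%classic : set R)).

Section uinterval_points.
Context {R : realType}.

Lemma ui0_subproof : (0 : R) \in (`[0, 1]%classic : set R).
Proof. by rewrite mem_setE in_itv /= lexx ler01. Qed.

Lemma ui1_subproof : (1 : R) \in (`[0, 1]%classic : set R).
Proof. by rewrite mem_setE in_itv /= lexx ler01. Qed.

Lemma uiflip_subproof (u : uinterval R) :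
  1 - set_val u \in (`[0, 1]%classic : set R).
Proof.
have := set_valP u; rewrite /= in_itv /= => /andP[u0 u1].
by rewrite mem_setE in_itv /= subr_ge0 u1 gerBl.
Qed.

Definition ui0 : uinterval R := exist _ 0 ui0_subproof.
Definition ui1 : uinterval R := exist _ 1 ui1_subproof.
Definition uiflip (u : uinterval R) : uinterval R :=
  exist _ (1 - set_val u) (uiflip_subproof u).

Definition uiend (u : uinterval R) : bool := (u == ui0) || (u == ui1).

Definition loop_rel' (u w : uinterval R) : bool :=
  (u == w) || (uiend u && uiend w).

Lemma loop_rel_refl : reflexive loop_rel'.
Proof. by move=> u; rewrite /loop_rel' eqxx. Qed.

Lemma loop_rel_sym : symmetric loop_rel'.
Proof. by move=> u w; rewrite /loop_rel' eq_sym andbC. Qed.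

Lemma loop_rel_trans : transitive loop_rel'.
Proof.
move=> w u z; rewrite /loop_rel' => /orP[/eqP->//|/andP[u01 w01]].
by case/orP => [/eqP<-|/andP[_ z01]]; rewrite u01 ?w01 ?z01 orbT.
Qed.

Definition loop_rel := EquivRel _ loop_rel_refl loop_rel_sym loop_rel_trans.

End uinterval_points.

(* A loop-edge: the unit interval with its two endpoints identified. *)
Definition loop (R : realType) : Type := {eq_quot @loop_rel R}.

HB.instance Definition _ (R : realType) := Quotient.on (loop R).
HB.instance Definition _ (R : realType) :=
  Topological.copy (loop R) (quotient_topology (loop R)).

Definition loop_pt (R : realType) (u : uinterval R) : loop R := \pi_(loop R) u.

Definition rose (R : realType) (r : nat) : Type :=
  wedge (fun _ : 'I_r => loop_pt (@ui0 R)).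

HB.instance Definition _ (R : realType) (r : nat) := Topological.on (rose R r).

(* [edge_pt e u] is the point at parameter [u] of the oriented edge [e]. *)
Definition edge_pt (R : realType) (r : nat) (e : letter r) (u : uinterval R) :
    rose R r :=
  @wedge_lift _ _ (fun _ : 'I_r => loop_pt (@ui0 R)) e.1
    (loop_pt (if e.2 then uiflip u else u)).

(* [f] sends the oriented edge [e] to the edge-path [p]: there is a subdivision
   0 = t_0 < ... < t_k = 1, k = size p >= 1, such that [f] maps the subsegment
   [t_j, t_(j+1)] of [e] affinely onto the j-th edge of [p]. The subdivision is
   arbitrary: it is not uniform for composites of graph maps. *)
Definition sends_edge (R : realType) (r : nat) (f : rose R r -> rose R r)
    (e : letter r) (p : seq (letter r)) : Prop :=
  (0 < size p)%N /\
  exists t : nat -> R,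
    [/\ t 0%N = 0, t (size p) = 1,
        forall j, (j < size p)%N -> t j < t j.+1 &
        forall j, (j < size p)%N -> forall s u : uinterval R,
          set_val u = (1 - set_val s) * t j + set_val s * t j.+1 ->
          f (edge_pt e u) = edge_pt (nth e p j) s].

(* Since all the points [edge_pt e ui0] coincide, the second clause says that
   [f] fixes the vertex. *)
Definition graph_map (R : realType) (r : nat) (f : rose R r -> rose R r) : Prop :=
  [/\ continuous f,
      (forall e, f (edge_pt e ui0) = edge_pt e ui0) &
      forall e, exists p, sends_edge f e p].

(* The edge-path f(e), which is unique when [f] is a graph map; [[::]] is a
   junk value. *)
Definition edge_path (R : realType) (r : nat) (f : rose R r -> rose R r)
    (e : letter r) : seq (letter r) :=
  xget [::] [set p | sends_edge f e p].

(* The subdivision point of the edge [x] is not prescribed. *)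
Definition nielsen_graph_map (R : realType) (r : nat) (th : nielsen r)
    (g : rose R r -> rose R r) : Prop :=
  graph_map g /\ forall z, sends_edge g z (nielsen_word th z).

(* The composite g_(theta_n) o ... o g_(theta_1). *)
Definition comp_seq (R : realType) (r : nat)
    (g : nielsen r -> rose R r -> rose R r) (ths : seq (nielsen r)) :
    rose R r -> rose R r :=
  foldl (fun f th => g th \o f) id ths.

Definition homotopic (R : realType) (X Y : topologicalType) (f g : X -> Y) : Prop :=
  exists H : X * uinterval R -> Y,
    [/\ continuous H, forall x, H (x, ui0) = f x & forall x, H (x, ui1) = g x].

Definition homotopy_equivalence (R : realType) (X Y : topologicalType)
    (f : X -> Y) : Prop :=
  continuous f /\
  exists h : Y -> X,
    [/\ continuous h, homotopic R (h \o f) id & homotopic R (f \o h) id].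

Definition train_track_map (R : realType) (r : nat)
    (f : rose R r -> rose R r) : Prop :=
  [/\ graph_map f, homotopy_equivalence R f &
      forall k e, (1 <= k)%N -> reduced (edge_path (iter k f) e)].

Definition Dmap (R : realType) (r : nat) (f : rose R r -> rose R r)
    (e : letter r) : letter r :=
  head e (edge_path f e).

(* The unordered pair {e, e'} is the finite set [[set e; e']]; it is degenerate
   when this set is a singleton. *)
Definition is_turn (r : nat) (T : {set letter r}) : Prop :=
  exists e e', T = [set e; e']%SET.

Definition nondegenerate_turn (r : nat) (T : {set letter r}) : bool := #|T| == 2%N.

Definition legal_turn (R : realType) (r : nat) (f : rose R r -> rose R r)
    (T : {set letter r}) : Prop :=
  nondegenerate_turn T /\
  forall k, (1 <= k)%N -> nondegenerate_turn [set iter k (Dmap f) e | e in T]%SET.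

Definition illegal_turn (R : realType) (r : nat) (f : rose R r -> rose R r)
    (T : {set letter r}) : Prop :=
  is_turn T /\ ~ legal_turn f T.

(* Main.v *)
(* The composite g sends every edge to the word obtained by applying the
   theta_i in turn, since edge-paths are determined by the map. The derivative
   of theta = [x |-> yx] identifies x with y, is injective otherwise, and misses
   x. By admissibility x is one of the two letters identified by the next
   derivative, so no further identification ever occurs: the only illegal turn
   is {x_1, y_1}. The same observation, applied to the turns inside theta(w)
   (images of turns of w, plus the new turn {y^-1, x}), shows that no word taking
   no illegal turn ever produces one, hence all iterates are reduced.

   For the homotopy equivalence, the inverse of theta is [x |-> y^-1 x], and the
   composite of the two graph maps sends x to y y^-1 x and fixes the other edges.
   On x it is the composite of a map [0, 1] -> [-1, 1] fixing 0 and 1 with the path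
   following the reverse of y and then x; the straight-line homotopy in [-1, 1]
   to the inclusion of [0, 1] contracts the backtracking. *)
Require Import Defs.
From mathcomp Require Import all_boot all_order all_algebra.
From mathcomp Require Import all_classical all_reals all_analysis.
From mathcomp Require Import homotopy.
From mathcomp Require Import lra ring.

Set Implicit Arguments.
Unset Strict Implicit.
Unset Printing Implicit Defensive.

Import Order.TTheory GRing.Theory Num.Theory.
Import numFieldNormedType.Exports.

Local Open Scope classical_set_scope.
Local Open Scope ring_scope.

(** * Combinatorics of words and turns under the substitutions *)

Section NielsenWords.
Context {r : nat}.
Implicit Types (th : nielsen r) (e a b : letter r) (p : seq (letter r)).

Lemma linvK : involutive (@linv r).
Proof. by case=> i c; rewrite /linv /= negbK. Qed.

Lemma linv_neq e : linv e != e.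
Proof. by case: e => i []; rewrite /linv /= xpair_eqE andbF. Qed.

(** The derivative of the graph map of [th]. The letter [linv (nx th)] has no case of its own
    because its word begins with itself. *)
Definition nielsen_head th z := if z == nx th then ny th else z.

Definition nielsen_path th p := flatten [seq nielsen_word th z | z <- p].

Definition nielsen_paths ths p := foldl (fun q th => nielsen_path th q) p ths.

Definition nielsen_heads ths z := foldl (fun e th => nielsen_head th e) z ths.

Lemma nielsen_wordE th z :
  exists q, nielsen_word th z = nielsen_head th z :: q.
Proof.
rewrite /nielsen_word /nielsen_head; case: eqP => _; first by eexists.
by case: eqP => [->|_]; eexists.
Qed.

(** The word of [linv z] is the reversed inverse of the word of [z], so the derivative also controls
    how a word ends. *)
Lemma last_nielsen_word th e z :
  last e (nielsen_word th z) = linv (nielsen_head th (linv z)).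
Proof.
rewrite /nielsen_word /nielsen_head.
have [->|zx] := eqVneq z (nx th); first by rewrite (negbTE (linv_neq _)) linvK.
by rewrite (can2_eq linvK linvK); case: eqP => //= _; rewrite linvK.
Qed.

Lemma head_nielsen_paths ths z q e :
  head e (nielsen_paths ths (z :: q)) = nielsen_heads ths z.
Proof.
elim: ths z q => //= th ths IH z q.
by rewrite /nielsen_path /=; have [w ->] := nielsen_wordE th z; rewrite IH.
Qed.

Lemma nielsen_head_neq th z : nielsen_head th z != nx th.
Proof. by rewrite /nielsen_head; have [_|] := eqVneq z (nx th); rewrite ?nielsen_neq. Qed.

(** The derivative moves only [nx th], and its value [ny th] is another letter that stays fixed; no
    other collision can occur. *)
Lemma nielsen_head_eq th a b :
  (nielsen_head th a == nielsen_head th b) =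
  (a == b) || ([set a; b]%SET == [set nx th; ny th]%SET).
Proof.
have xy := negbTE (nielsen_neq th); have yx := xy; rewrite eq_sym in yx.
apply/idP/orP; rewrite /nielsen_head.
  have [->|ax] := eqVneq a (nx th); have [->|bx] := eqVneq b (nx th).
  - by left.
  - by move=> /eqP <-; right.
  - by move=> /eqP ->; rewrite finset.setUC; right.
  - by left.
case=> [/eqP->//|/eqP /setP E].
have := E a; have := E b; have := E (nx th); have := E (ny th).
rewrite !inE !eqxx !orbT /= !(eq_sym (nx th)) !(eq_sym (ny th)).
have [->|ax] := eqVneq a (nx th); have [->|bx] := eqVneq b (nx th) => //=.
by rewrite yx => /eqP ->.
Qed.

Lemma admissible_mem th th' :
  admissible th th' -> (nx th == nx th') || (nx th == ny th').
Proof.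
by case/orP => /andP[/eqP -> _]; rewrite eqxx ?orbT.
Qed.

(* [nielsen_head th] misses [nx th], one of the two letters that
   [nielsen_head th'] identifies. *)
Lemma admissible_nielsen_head th th' a b : admissible th th' ->
  nielsen_head th a != nielsen_head th b ->
  nielsen_head th' (nielsen_head th a) != nielsen_head th' (nielsen_head th b).
Proof.
move=> adm ab; rewrite nielsen_head_eq negb_or ab /=; apply/eqP => /setP.
move=> /(_ (nx th)); rewrite !inE (admissible_mem adm).
by rewrite !(eq_sym (nx th)) !(negbTE (nielsen_head_neq _ _)).
Qed.

(** Consecutive letters [e], [e'] take the turn formed by [linv e] and [e']. Only the derivative of
    [th] is tested; degenerate turns fail the test too, whence reducedness. *)
Definition takes_no_illegal_turn th p : bool :=
  sorted (fun e e' => nielsen_head th (linv e) != nielsen_head th e') p.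

Lemma takes_no_illegal_turn_reduced th p : takes_no_illegal_turn th p -> reduced p.
Proof.
by apply: sub_sorted => e e'; apply: contraNneq => ->.
Qed.

(** Both two-letter words take the single turn {y^-1, x}. If it were {x', y'}, then x' = x would
    force y' = y^-1 and y' = x would force x' = y^-1, which admissibility excludes. *)
Lemma nielsen_word_no_illegal_turn th th' z : admissible th th' ->
  takes_no_illegal_turn th' (nielsen_word th z).
Proof.
have := nielsen_neq th; have := nielsen_neqV th; have := nielsen_neq th'.
rewrite /takes_no_illegal_turn /admissible /nielsen_word /nielsen_head.
have yVx : (linv (ny th) == nx th) = (ny th == linv (nx th)).
  by rewrite (can2_eq linvK linvK).
move=> n' nV n adm.
have key : nielsen_head th' (linv (ny th)) != nielsen_head th' (nx th).
  rewrite nielsen_head_eq yVx (negbTE nV) /=; apply/eqP => /setP E.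
  case/orP: adm => /andP[/eqP E1 /negP]; apply; apply/eqP.
    have := E (ny th'); rewrite !inE eqxx orbT -E1 (negbTE n') orbF.
    by move/eqP.
  have := E (nx th'); rewrite !inE eqxx -E1 [nx th' == ny th']eq_sym (negbTE n').
  by rewrite orbF => /eqP.
case: eqP => _ /=; first by rewrite andbT.
by case: eqP => _ //=; rewrite andbT linvK eq_sym.
Qed.

(** A turn of the image lies inside the word of one letter, or sits at the junction of two words and
    is then the derivative of a turn of [p]. *)
Lemma nielsen_path_no_illegal_turn th th' p : admissible th th' ->
  takes_no_illegal_turn th p -> takes_no_illegal_turn th' (nielsen_path th p).
Proof.
move=> adm; elim: p => // a [_ _|b p IH].
  by rewrite /nielsen_path /= cats0; exact: nielsen_word_no_illegal_turn.
move=> /= /andP[ab bp]; have := IH bp.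
rewrite {1 2}/takes_no_illegal_turn /nielsen_path /=.
have [w Eb] := nielsen_wordE th b.
have [v Ea] := nielsen_wordE th a.
have := nielsen_word_no_illegal_turn a adm.
have := last_nielsen_word th a a.
rewrite Eb Ea /takes_no_illegal_turn /= => La Pa.
move=> Pb; rewrite cat_path Pa La /= linvK Pb andbT.
exact: admissible_nielsen_head.
Qed.

Lemma nielsen_paths_no_illegal_turn th ths p : path (@admissible r) th ths ->
  takes_no_illegal_turn th p ->
  takes_no_illegal_turn (last th ths) (nielsen_paths (belast th ths) p).
Proof.
elim: ths th p => //= th' ths IH th p /andP[adm pth] tp.
exact/IH/(nielsen_path_no_illegal_turn adm).
Qed.

Lemma path_nielsen_heads th ths a b : path (@admissible r) th ths ->
  nielsen_head th a != nielsen_head th b ->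
  nielsen_head (last th ths) (nielsen_heads (belast th ths) a) !=
  nielsen_head (last th ths) (nielsen_heads (belast th ths) b).
Proof.
elim: ths th a b => //= th' ths IH th a b /andP[adm pth] ab.
exact/IH/admissible_nielsen_head.
Qed.

Lemma iter_nielsen_paths th ths k e : cyclically_admissible (th :: ths) ->
  takes_no_illegal_turn th (iter k (nielsen_paths (th :: ths)) [:: e]).
Proof.
(* Cyclic admissibility unfolds to a path from [th] along [rcons ths th]: its [belast] is the whole
   sequence and its last element is [th] again, so one round preserves the invariant. *)
move=> adm; elim: k => // k /(nielsen_paths_no_illegal_turn adm).
by rewrite last_rcons belast_rcons.
Qed.

Lemma iter_nielsen_heads th ths k a b : cyclically_admissible (th :: ths) ->
  (iter k.+1 (nielsen_heads (th :: ths)) a ==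
     iter k.+1 (nielsen_heads (th :: ths)) b) =
  (nielsen_head th a == nielsen_head th b).
Proof.
move=> adm; apply/idP/idP => [|/eqP E]; last first.
  by rewrite !iterSr /= E.
apply: contraTT => ab.
(* The invariant carried by the induction is stronger: the images stay apart even after one further
   derivative of [th]. *)
suff : nielsen_head th (iter k.+1 (nielsen_heads (th :: ths)) a) !=
    nielsen_head th (iter k.+1 (nielsen_heads (th :: ths)) b).
  by apply: contraNneq => ->.
elim: k.+1 => {k}// k /(path_nielsen_heads adm).
by rewrite last_rcons belast_rcons.
Qed.

End NielsenWords.

(** * Points of the rose, and uniqueness and composition of edge-paths *)

Section RoseEdges.
Context {R : realType} {r : nat}.
Implicit Types (e x y : letter r) (u s : uinterval R) (p q : seq (letter r)).

Lemma uinterval_ge0 u : 0 <= set_val u.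
Proof. by have := set_valP u; rewrite /= in_itv /= => /andP[]. Qed.

Lemma uinterval_le1 u : set_val u <= 1.
Proof. by have := set_valP u; rewrite /= in_itv /= => /andP[]. Qed.

Lemma clamp_subproof (v : R) :
  Num.max 0 (Num.min 1 v) \in (`[0, 1]%classic : set R).
Proof.
by rewrite mem_setE in_itv /= le_max lexx ge_max ler01 ge_min lexx.
Qed.

(** The retraction of the line onto the unit interval; it builds points of the subtype from real
    formulas and is continuous. *)
Definition clamp (v : R) : uinterval R :=
  exist _ (Num.max 0 (Num.min 1 v)) (clamp_subproof v).

Lemma clampK u : clamp (set_val u) = u.
Proof.
by apply/val_inj; rewrite /= (min_r (uinterval_le1 u)) (max_r (uinterval_ge0 u)).
Qed.

Lemma val_clamp (v : R) : 0 <= v <= 1 -> set_val (clamp v) = v.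
Proof. by move=> /andP[v0 v1]; rewrite set_valE /= min_r// max_r. Qed.

Lemma clamp0 : clamp 0 = ui0.
Proof. by rewrite -[RHS]clampK. Qed.

Lemma clamp1 : clamp 1 = ui1.
Proof. by rewrite -[RHS]clampK. Qed.

Lemma clamp_le0 (v : R) : v <= 0 -> clamp v = ui0.
Proof.
move=> v0; apply/val_inj => /=; rewrite min_r ?max_l//.
by rewrite (le_trans v0).
Qed.

Lemma uiflipK : involutive (@uiflip R).
Proof. by move=> u; apply/val_inj; rewrite /= set_valE /= opprB addrC subrK. Qed.

Lemma uiend_flip u : uiend (uiflip u) = uiend u.
Proof.
rewrite /uiend orbC; congr orb.
  rewrite (can2_eq uiflipK uiflipK); congr (_ == _).
  by apply/val_inj; rewrite /= subrr.
rewrite (can2_eq uiflipK uiflipK); congr (_ == _).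
by apply/val_inj; rewrite /= subr0.
Qed.

Lemma uiendP u : reflect (set_val u = 0 \/ set_val u = 1) (uiend u).
Proof.
apply: (iffP orP) => [[/eqP ->|/eqP ->]|[u0|u1]]; rewrite ?set_valE;
  [by left|by right|left|right].
  by apply/eqP/val_inj.
by apply/eqP/val_inj.
Qed.

Lemma loop_pt_end u s : uiend u -> uiend s -> loop_pt u = loop_pt s.
Proof. by move=> u01 s01; apply/eqmodP; rewrite /= /loop_rel' u01 s01 orbT. Qed.

Lemma edge_pt_end e x u s : uiend u -> uiend s -> edge_pt e u = edge_pt x s.
Proof.
suff {e x u s} E e u : uiend u ->
    edge_pt e u = @wedge_lift _ _ (fun _ => loop_pt (@ui0 R)) e.1 (loop_pt ui0).
  move=> u01 s01; rewrite (E _ _ u01) (E _ _ s01).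
  exact: (@wedge_liftE _ _ (fun _ : 'I_r => loop_pt (@ui0 R)) _ (loop_pt ui0)
    _ (loop_pt ui0)).
move=> u01; rewrite /edge_pt (@loop_pt_end _ ui0)//.
  by case: ifP; rewrite ?uiend_flip.
by rewrite /uiend eqxx.
Qed.

Lemma edge_pt_linv e u : edge_pt (linv e) u = edge_pt e (uiflip u).
Proof. by rewrite /edge_pt /=; case: e.2 => //=; rewrite uiflipK. Qed.

(** Serves to tell points of the rose apart. Both endpoints give [None], so the value is independent
    of the representative and of the loop at the vertex. *)
Definition loop_coordinate (i : 'I_r) (l : loop R) : option ('I_r * R) :=
  if uiend (repr l) then None else Some (i, set_val (repr l)).

Definition rose_coordinate : rose R r -> option ('I_r * R) :=
  wedge_fun loop_coordinate.

Lemma loop_coordinateE i u : loop_coordinate i (loop_pt u) =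
  if uiend u then None else Some (i, set_val u).
Proof.
rewrite /loop_coordinate /loop_pt; case: piP => s /eqmodP /=.
by rewrite /loop_rel' => /predU1P[->//|/andP[-> ->]].
Qed.

Lemma rose_coordinateE e u : rose_coordinate (edge_pt e u) =
  if uiend u then None else
  Some (e.1, if e.2 then 1 - set_val u else set_val u).
Proof.
rewrite /rose_coordinate /edge_pt wedge_lift_funE; last first.
  by move=> i j; rewrite !loop_coordinateE /uiend eqxx.
by rewrite loop_coordinateE; case: e.2; rewrite ?uiend_flip ?set_valE.
Qed.

Implicit Types f g : rose R r -> rose R r.

Definition sends_piece f e x (a b : R) : Prop :=
  forall s u, set_val u = (1 - set_val s) * a + set_val s * b ->
    f (edge_pt e u) = edge_pt x s.

(* A recursive form of [sends_edge], for the part [[a, c]] of the edge [e]. *)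
Fixpoint sends_segment f e p (a c : R) : Prop :=
  if p is x :: q then exists b,
    [/\ a < b, sends_piece f e x a b & sends_segment f e q b c]
  else a = c.

Lemma sends_edgeP f e p : sends_edge f e p <-> sends_segment f e p 0 1.
Proof.
have E q (a c : R) : sends_segment f e q a c <-> exists t : nat -> R,
    [/\ t 0%N = a, t (size q) = c,
        forall j, (j < size q)%N -> t j < t j.+1 &
        forall j, (j < size q)%N -> forall s u : uinterval R,
          set_val u = (1 - set_val s) * t j + set_val s * t j.+1 ->
          f (edge_pt e u) = edge_pt (nth e q j) s].
  elim: q a => [|x q IH] a /=.
    split=> [<-|[t [-> <-//]]].
    by exists (fun=> a).
  split=> [[b [ab Hx /IH[t [t0 t1 tlt Ht]]]]|[t [t0 t1 tlt Ht]]].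
    exists (fun j => if j is j'.+1 then t j' else a); split => //.
      by case=> [_|j /tlt//]; rewrite t0.
    case=> [_ s u|j jq s u]; last exact: Ht.
    by rewrite t0; exact: Hx.
  exists (t 1%N); split.
  - by rewrite -t0; exact: tlt.
  - by move=> s u; rewrite -t0; exact: (Ht 0%N).
  - apply/IH; exists (fun j => t j.+1); split => // j jq.
      exact: (tlt j.+1).
    exact: (Ht j.+1).
split=> [[_ /E//]|H]; split; last exact/E.
by case: p H => //= /eqP; rewrite eq_sym oner_eq0.
Qed.

Lemma sends_segment_le f e p a c : sends_segment f e p a c -> a <= c.
Proof.
by elim: p a => [a ->//|x q IH a /= [b [ab _ /IH]]]; apply/le_trans/ltW.
Qed.

Lemma sends_segment_cat f e p q a b c :
  sends_segment f e p a b -> sends_segment f e q b c ->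
  sends_segment f e (p ++ q) a c.
Proof.
elim: p a => [a -> //|x p IH a /= [b' [ab' Hx Hp]] Hq].
by exists b'; split => //; exact: IH.
Qed.

(** Each piece of [e] that [f] maps onto a letter [x] is refined by pulling back the subdivision of
    [x] for [g]. *)
Lemma sends_edge_comp f g e p (w : letter r -> seq (letter r)) :
  sends_edge f e p -> (forall z, sends_edge g z (w z)) ->
  sends_edge (g \o f) e (flatten [seq w z | z <- p]).
Proof.
move=> /sends_edgeP Hf Hg; apply/sends_edgeP.
elim: p 0 Hf => //= x p IH a [b [ab Hx Hp]].
apply: sends_segment_cat (IH _ Hp).
have /sends_edgeP := Hg x; move: (w x) => q.
(* The affine map from [0, 1] onto [a, b] transports the subdivision of [x]; the starting point a'
   is generalised for the induction. *)
suff : forall a', 0 <= a' -> sends_segment g x q a' 1 ->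
    sends_segment (g \o f) e q (a + a' * (b - a)) b.
  by move=> /(_ 0 (lexx 0)); rewrite mul0r addr0.
elim: q => [a' _ /= ->|y q IHq a' a'0 /= [b' [ab' Hy Hq]]].
  by rewrite mul1r addrC subrK.
exists (a + b' * (b - a)); split.
- by rewrite ltrD2l ltr_pM2r// subr_gt0.
- move=> s u us.
  pose v : uinterval R := clamp ((1 - set_val s) * a' + set_val s * b').
  have b'1 := sends_segment_le Hq.
  have Ev : set_val v = (1 - set_val s) * a' + set_val s * b'.
    have := uinterval_ge0 s; have := uinterval_le1 s => s1 s0.
    by apply: val_clamp; apply/andP; split; nra.
  rewrite -(Hy s v Ev) /=; congr g; apply: Hx.
  by rewrite us Ev; ring.
- by apply: IHq => //; lra.
Qed.

(** If b < b', the point at b would go to the vertex by the first piece, and by the second to the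
    interior point of [y] with parameter (b - a) / (b' - a). *)
Lemma sends_piece_le f e x y a b b' : 0 <= a -> a < b -> b' <= 1 ->
  sends_piece f e x a b -> sends_piece f e y a b' -> b' <= b.
Proof.
move=> a0 ab b'1 Hx Hy; rewrite leNgt; apply/negP => bb'.
have Eb : set_val (clamp b) = b by apply: val_clamp; lra.
have : f (edge_pt e (clamp b)) = edge_pt x ui1.
  by apply: Hx; rewrite Eb set_valE /=; ring.
have t0 : 0 < (b - a) / (b' - a) by rewrite divr_gt0//; lra.
have t1 : (b - a) / (b' - a) < 1 by rewrite ltr_pdivrMr; lra.
have Et : set_val (clamp ((b - a) / (b' - a))) = (b - a) / (b' - a).
  by apply: val_clamp; rewrite !ltW.
rewrite (Hy (clamp ((b - a) / (b' - a)))); last by rewrite Eb Et; field; lra.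
move/(congr1 rose_coordinate); rewrite !rose_coordinateE.
have -> : uiend (@ui1 R) by rewrite /uiend eqxx orbT.
by case: uiendP => // -[]; rewrite Et => ? _; lra.
Qed.

Lemma sends_piece_inj f e x y a b : 0 <= a -> a < b -> b <= 1 ->
  sends_piece f e x a b -> sends_piece f e y a b -> x = y.
Proof.
move=> a0 ab b1 Hx Hy.
(* The midpoint would not tell [x] from [linv x]. *)
have Et : set_val (clamp (1 / 3)) = 1 / 3 :> R by apply: val_clamp; lra.
have Em : set_val (clamp ((1 - 1 / 3) * a + 1 / 3 * b)) =
    (1 - 1 / 3) * a + 1 / 3 * b by apply: val_clamp; lra.
have := Hx (clamp (1 / 3)) (clamp ((1 - 1 / 3) * a + 1 / 3 * b)).
rewrite (Hy (clamp (1 / 3))) Em Et// => /(_ erefl).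
move/(congr1 rose_coordinate); rewrite !rose_coordinateE Et.
case: uiendP => [[]|_ [Ei Eb]]; [by rewrite Et => ?; exfalso; lra..|].
case: x y {Hx Hy} Ei Eb => [i bi] [j bj] /= -> E; congr pair.
by move: bi bj E => [] []//= ?; exfalso; lra.
Qed.

(** The first subdivision points agree by two opposite inequalities, then the first letters agree,
    and induction handles the rest. Hence [edge_path] is determined by the map. *)
Lemma sends_segment_uniq f e p q a c : 0 <= a -> c <= 1 ->
  sends_segment f e p a c -> sends_segment f e q a c -> p = q.
Proof.
move=> a0 c1; elim: p q a a0 => [|x p IH] [|y q] a a0 //=.
- by move=> -> [b [ab _ /sends_segment_le]]; rewrite leNgt ab.
- by move=> [b [ab _ /sends_segment_le]] + E; rewrite -E leNgt ab.
move=> [b [ab Hx Hp]] [b' [ab' Hy Hq]].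
have bc := sends_segment_le Hp; have b'c := sends_segment_le Hq.
have Eb : b = b'.
  apply/eqP; rewrite eq_le (sends_piece_le a0 ab' _ Hy Hx) ?(le_trans bc)//.
  by rewrite (sends_piece_le a0 ab _ Hx Hy)// (le_trans b'c).
rewrite -{}Eb in ab' Hy Hq b'c *.
rewrite (sends_piece_inj a0 ab _ Hx Hy) ?(le_trans bc)//; congr cons.
by apply: IH Hp Hq; lra.
Qed.

Lemma edge_pathE f e p : sends_edge f e p -> edge_path f e = p.
Proof.
move=> Hp; rewrite /edge_path; case: xgetP => [q _ /= Hq|/(_ p)//].
by apply: (@sends_segment_uniq f e _ _ 0 1) => //; exact/sends_edgeP.
Qed.

Lemma sends_edge_id e : sends_edge (@id (rose R r)) e [:: e].
Proof.
apply/sends_edgeP; exists 1; split => // s u us; have -> // : u = s.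
by apply/val_inj; rewrite -!set_valE us; ring.
Qed.

End RoseEdges.

(** * Composition and pairing of continuous maps *)

Section Continuity.

Lemma continuous_compT (T U V : topologicalType) (f : T -> U) (g : U -> V) :
  continuous f -> continuous g -> continuous (g \o f).
Proof. by move=> cf cg x; apply: continuous_comp; [exact: cf|exact: cg]. Qed.

Lemma continuous_pair (T U V : topologicalType) (f : T -> U) (g : T -> V) :
  continuous f -> continuous g -> continuous (fun x => (f x, g x)).
Proof. by move=> cf cg x; apply: cvg_pair; [exact: cf|exact: cg]. Qed.

Lemma continuous_fst (T U : topologicalType) : continuous (@fst T U).
Proof. by move=> x; exact: cvg_fst. Qed.

Lemma continuous_snd (T U : topologicalType) : continuous (@snd T U).
Proof. by move=> x; exact: cvg_snd. Qed.

End Continuity.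

(** * Pasting of maps, and topology of the unit interval *)

Section Gluing.
Context {R : realType}.

(** The pasting lemma for the closed sets h <= 0 and 0 <= h, which cover the domain and meet where h
    = 0. *)
Lemma continuous_glue (T U : topologicalType) (h : T -> R) (f g : T -> U) :
  continuous h -> continuous f -> continuous g ->
  (forall x, h x = 0 -> f x = g x) ->
  continuous (fun x => if h x <= 0 then f x else g x).
Proof.
move=> ch cf cg fg; pose k x := if h x <= 0 then f x else g x.
have cA : closed [set x | h x <= 0].
  by apply: (@closed_comp _ _ h [set v : R | v <= 0]) => [x _|];
    [exact: ch|exact: closed_le].
have cB : closed [set x | 0 <= h x].
  by apply: (@closed_comp _ _ h [set v : R | 0 <= v]) => [x _|];
    [exact: ch|exact: closed_ge].
have : {within [set x | h x <= 0] `|` [set x | 0 <= h x], continuous k}.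
  apply: withinU_continuous => //.
    apply: (@subspace_eq_continuous _ _ _ f); last exact: continuous_subspaceT.
    by move=> x /set_mem /= hx; rewrite /from_subspace /k hx.
  apply: (@subspace_eq_continuous _ _ _ g); last exact: continuous_subspaceT.
  move=> x /set_mem /= hx; rewrite /from_subspace /k; case: ifP => // hx'.
  by apply/esym/fg/eqP; rewrite eq_le hx'.
rewrite (_ : _ `|` _ = setT); last first.
  by apply/seteqP; split => // x _; case: (leP (h x) 0) => hx; [left|right; exact: ltW].
exact: (continuous_subspace_setT k).2.
Qed.

Lemma continuous_set_val (A : set R) : continuous (set_val : A -> R).
Proof. exact: initial_continuous. Qed.

Lemma continuous_clamp : continuous (@clamp R).
Proof.
apply: continuous_comp_initial.
rewrite (_ : _ \o _ = (fun=> 0) \max ((fun=> 1) \min id) :> (R -> R)); last first.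
  by apply/funext => v; rewrite /= set_valE.
move=> v; apply: (@continuous_max R R); first exact: cvg_cst.
by apply: (@continuous_min R R); [exact: cvg_cst|exact: cvg_id].
Qed.

Lemma compact_uinterval : compact [set: uinterval R].
Proof.
have -> : [set: uinterval R] = @clamp R @` `[0, 1].
  apply/seteqP; split => // u _; exists (set_val u); last exact: clampK.
  exact: set_valP.
apply: continuous_compact; last exact: segment_compact.
exact/continuous_subspaceT/continuous_clamp.
Qed.

(** Used to uncurry a map into the compact-open function space in [rose_homotopic]. *)
Lemma locally_compact_uinterval : locally_compact [set: uinterval R].
Proof.
move=> u _; rewrite withinET; exists setT; first exact: filterT.
by split; [exact: compact_uinterval|exact: closedT].
Qed.

End Gluing.

(** * Homotopies and homotopy equivalences *)

Section Homotopy.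
Context {R : realType}.

Lemma homotopic_trans (X Y : topologicalType) (f g h : X -> Y) :
  homotopic R f g -> homotopic R g h -> homotopic R f h.
Proof.
move=> [F [cF F0 F1]] [G [cG G0 G1]].
pose s (w : X * uinterval R) : R := set_val w.2.
have cs : continuous s.
  exact: continuous_compT (@continuous_snd _ _) (@continuous_set_val _ _).
(* The two homotopies run in succession at double speed; [clamp] makes each half total and changes
   nothing on its own half. *)
pose F' (w : X * uinterval R) := F (w.1, clamp (2 * s w)).
pose G' (w : X * uinterval R) := G (w.1, clamp (2 * s w - 1)).
exists (fun w => if s w - 1 / 2 <= 0 then F' w else G' w); split.
- apply: continuous_glue => [w|||w].
  + by apply: cvgB; [exact: cs|exact: cvg_cst].
  + apply: continuous_compT cF; apply: continuous_pair.
      exact: continuous_fst.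
    apply: continuous_compT continuous_clamp => w.
    by apply: cvgM; [exact: cvg_cst|exact: cs].
  + apply: continuous_compT cG; apply: continuous_pair.
      exact: continuous_fst.
    apply: continuous_compT continuous_clamp => w.
    by apply: cvgB; [apply: cvgM; [exact: cvg_cst|exact: cs]|exact: cvg_cst].
  + rewrite /F' /G' => sw; have -> : s w = 1 / 2 by lra.
    have -> : 2 * (1 / 2) = 1 :> R by field.
    by rewrite subrr clamp0 clamp1 F1 G0.
- move=> x; rewrite /F' /s set_valE /= mulr0 clamp0 F0 ifT//; lra.
- move=> x; rewrite /G' /s set_valE /= mulr1 ifF; last by apply/negbTE; lra.
  by rewrite (_ : 2 - 1 = 1) ?clamp1 ?G1//; lra.
Qed.

Lemma homotopic_comp (X Y Z W : topologicalType) (k : X -> Y) (f g : Y -> Z)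
    (h : Z -> W) :
  continuous k -> continuous h -> homotopic R f g ->
  homotopic R (h \o f \o k) (h \o g \o k).
Proof.
move=> ck ch [F [cF F0 F1]].
exists (fun w => h (F (k w.1, w.2))); split=> [|x|x] /=; rewrite ?F0 ?F1//.
apply: continuous_compT ch; apply: continuous_compT cF.
apply: continuous_pair (@continuous_snd _ _).
exact: continuous_compT (@continuous_fst _ _) ck.
Qed.

Lemma homotopy_equivalence_comp (X Y Z : topologicalType) (f : X -> Y) (g : Y -> Z) :
  homotopy_equivalence R f -> homotopy_equivalence R g ->
  homotopy_equivalence R (g \o f).
Proof.
move=> [cf [f' [cf' f'f ff']]] [cg [g' [cg' g'g gg']]].
split; first exact: continuous_compT cf cg.
exists (f' \o g'); split.
- exact: continuous_compT cg' cf'.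
- exact: homotopic_trans (homotopic_comp cf cf' g'g) f'f.
- exact: homotopic_trans (homotopic_comp cg' cg ff') gg'.
Qed.

Lemma homotopy_equivalence_id (X : topologicalType) :
  homotopy_equivalence R (@id X).
Proof.
have cid : continuous (@id X) by move=> x; exact: cvg_id.
have hid : homotopic R (@id X) id.
  by exists fst; split => // w; exact: cvg_fst.
by split => //; exists id; split.
Qed.

End Homotopy.

(** * Homotopies on the rose and contraction of a backtracking path *)

Section RoseHomotopy.
Context {R : realType} {r : nat}.
Implicit Types (x y z e : letter r) (f g : rose R r -> rose R r).

Lemma continuous_loop_pt : continuous (@loop_pt R).
Proof. exact: pi_continuous. Qed.

Lemma continuous_uiflip : continuous (@uiflip R).
Proof.
rewrite (_ : @uiflip R = @clamp R \o (fun u => 1 - set_val u)); last first.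
  by apply/funext => u; rewrite -[LHS]clampK.
apply: continuous_compT continuous_clamp => u.
apply: (@cvgB R R^o _ (nbhs u) _ (fun=> 1) set_val);
  [exact: cvg_cst|exact: continuous_set_val].
Qed.

Lemma continuous_edge_pt e : continuous (@edge_pt R r e).
Proof.
rewrite /edge_pt; apply: (@continuous_compT _ _ _
    (fun u => loop_pt (if e.2 then uiflip u else u)) (@wedge_lift _ _ _ e.1)).
  case: e.2; last exact: continuous_loop_pt.
  exact: continuous_compT continuous_uiflip continuous_loop_pt.
exact: wedge_lift_continuous.
Qed.

Lemma rose_ind (P : rose R r -> Prop) :
  (forall i u, P (edge_pt (i, false) u)) -> forall w, P w.
Proof.
move=> H w; have : [set: rose R r] w by [].
rewrite -(wedgeTE (fun _ : 'I_r => loop_pt (@ui0 R))) => -[i _ [l _ <-]].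
by rewrite -[l]reprK; exact: H.
Qed.

(* Currying reduces continuity on the product of the rose with the interval to
   the universal property of the quotient. *)
Lemma rose_homotopic f g (K : 'I_r -> uinterval R * uinterval R -> rose R r) :
  (forall i, continuous (K i)) ->
  (forall i u s, uiend u -> K i (u, s) = edge_pt (i, false) ui0) ->
  (forall i u, K i (u, ui0) = f (edge_pt (i, false) u)) ->
  (forall i u, K i (u, ui1) = g (edge_pt (i, false) u)) ->
  homotopic R f g.
Proof.
move=> cK Kend K0 K1.
have vtx i j : edge_pt (i, false) ui0 = edge_pt (j, false) ui0 :> rose R r.
  by apply: edge_pt_end; rewrite /uiend eqxx.
(* At both endpoints [K i] is the constant path at the vertex, so its curried form descends to the
   loop and then to the wedge. *)
pose L i : loop R -> {compact-open, uinterval R -> rose R r} :=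
  (curry (K i) : _ -> {compact-open, uinterval R -> rose R r}) \o repr.
have cL i : continuous (L i).
  apply: repr_comp_continuous; first exact: continuous_curry_fun.
  move=> u u' /eqP /eqmodP /predU1P[-> //|/andP[u01 u01']].
  by apply/eqP/funext => s; rewrite /curry !Kend.
have LE i u : L i (loop_pt u) = curry (K i) u.
  rewrite /L /= /loop_pt; case: piP => u' /eqmodP /predU1P[-> //|/andP[u01 u01']].
  by apply/funext => s; rewrite /curry !Kend.
have Lend i j : L i (loop_pt ui0) = L j (loop_pt ui0).
  rewrite !LE; apply/funext => s; rewrite /curry !Kend ?(vtx i j)//;
    by rewrite /uiend eqxx.
pose H : rose R r -> {compact-open, uinterval R -> rose R r} := wedge_fun L.
have cH : continuous H by exact: wedge_fun_continuous.
have HE i u : H (edge_pt (i, false) u) = curry (K i) u.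
  by rewrite /H /edge_pt wedge_lift_funE.
exists (uncurry H); split.
- apply: continuous_uncurry_regular => //.
  + exact: locally_compact_uinterval.
  + exact: uniform_regular.
  + move=> w; elim/rose_ind: w => i u; rewrite HE.
    by have [] := continuous_curry (cK i).
- by move=> w; elim/rose_ind: w => i u; rewrite /= HE /curry K0.
- by move=> w; elim/rose_ind: w => i u; rewrite /= HE /curry K1.
Qed.

(** On [-1, 1] this path follows the reverse of [y], passes the vertex at 0 and then follows [x]; it
    is constant beyond. *)
Definition bend x y (v : R) : rose R r :=
  if v <= 0 then edge_pt y (clamp (- v)) else edge_pt x (clamp v).

Lemma bend_ge0 x y v : 0 <= v -> bend x y v = edge_pt x (clamp v).
Proof.
move=> v0; rewrite /bend; case: ifP => // v0'.
by apply: edge_pt_end; rewrite clamp_le0 ?oppr_le0// /uiend eqxx.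
Qed.

Lemma bend_le0 x y v : v <= 0 -> bend x y v = edge_pt y (clamp (- v)).
Proof. by rewrite /bend => ->. Qed.

Lemma continuous_bend x y : continuous (bend x y).
Proof.
apply: continuous_glue.
- exact: (fun v => @cvg_id _ (nbhs v)).
- apply: continuous_compT (@continuous_edge_pt y).
  apply: continuous_compT continuous_clamp => v.
  by apply: cvgN; exact: cvg_id.
- by apply: continuous_compT (@continuous_edge_pt x); exact: continuous_clamp.
- by move=> v ->; apply: edge_pt_end; rewrite clamp_le0 ?oppr0// /uiend eqxx.
Qed.

(* The parameter in [-1, 1] of the position along the path [y; linv y; x],
   where negative parameters lie on [y] and positive ones on [x]. *)
Definition backtrack (t1 t2 v : R) : R :=
  Num.max (- (v / t1))
    (Num.max (v - t2) 0 / (1 - t2) + Num.min (v - t2) 0 / (t2 - t1)).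

(** Written with maxima and minima instead of cases, the formula is continuous by the lattice
    operations. *)
Lemma continuous_backtrack (t1 t2 : R) : continuous (backtrack t1 t2).
Proof.
have cB : continuous (fun v : R => v - t2).
  by move=> v; apply: cvgB; [exact: cvg_id|exact: cvg_cst].
have c1 : continuous (fun v : R => - (v / t1)).
  by move=> v; apply: cvgN; apply: cvgM; [exact: cvg_id|exact: cvg_cst].
have c2 : continuous (fun v : R => Num.max (v - t2) 0 / (1 - t2)).
  move=> v; apply: cvgM; last exact: cvg_cst.
  exact: (continuous_max (cB v) (cvg_cst _)).
have c3 : continuous (fun v : R => Num.min (v - t2) 0 / (t2 - t1)).
  move=> v; apply: cvgM; last exact: cvg_cst.
  exact: (continuous_min (cB v) (cvg_cst _)).
by move=> v; apply: (continuous_max (c1 v)); apply: cvgD; [exact: c2|exact: c3].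
Qed.

Lemma backtrack_le (t1 t2 v : R) : v <= t2 ->
  backtrack t1 t2 v = Num.max (- (v / t1)) ((v - t2) / (t2 - t1)).
Proof.
rewrite -subr_le0 => vt2.
by rewrite /backtrack (max_r vt2) (min_l vt2) mul0r add0r.
Qed.

(** The two arguments of the maximum cross at t1, where both equal -1; comparison with -1 decides
    which is larger. *)
Lemma backtrack1 (t1 t2 v : R) : 0 < t1 -> t1 < t2 ->
  0 <= v <= t1 -> backtrack t1 t2 v = - (v / t1).
Proof.
move=> t1_gt0 t12 /andP[v0 v1]; rewrite backtrack_le; last lra.
apply: max_l; apply: (@le_trans _ _ (-1)).
  by rewrite ler_pdivrMr; lra.
by rewrite lerN2 ler_pdivrMr// mul1r.
Qed.

Lemma backtrack2 (t1 t2 v : R) : 0 < t1 -> t1 < t2 ->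
  t1 <= v <= t2 -> backtrack t1 t2 v = (v - t2) / (t2 - t1).
Proof.
move=> t1_gt0 t12 /andP[v0 v1]; rewrite backtrack_le//.
apply: max_r; apply: (@le_trans _ _ (-1)).
  by rewrite lerN2 ler_pdivlMr// mul1r.
by rewrite ler_pdivlMr; lra.
Qed.

Lemma backtrack3 (t1 t2 v : R) : 0 < t1 -> t1 < t2 -> t2 < 1 ->
  t2 <= v <= 1 -> backtrack t1 t2 v = (v - t2) / (1 - t2).
Proof.
move=> t1_gt0 t12 t2_lt1 /andP[v0 v1]; have vt2 : 0 <= v - t2 by lra.
rewrite /backtrack (max_l vt2) (min_r vt2) mul0r addr0.
apply: max_r; apply: (@le_trans _ _ 0).
  by rewrite oppr_le0 divr_ge0//; lra.
by rewrite divr_ge0//; lra.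
Qed.

(** The numbers t1 and t2 are the inner subdivision points of the edge [x]. *)
Lemma sends_edge_backtrack f x y : sends_edge f x [:: y; linv y; x] ->
  exists t1 t2, [/\ 0 < t1, t1 < t2, t2 < 1 &
    forall u, f (edge_pt x u) = bend x y (backtrack t1 t2 (set_val u))].
Proof.
move/sends_edgeP => [t1 [t1_gt0 H1 [t2 [t12 H2 [t3 [t2_lt1 H3 /= Et]]]]]].
rewrite {}Et in t2_lt1 H3; exists t1, t2; split => // u.
have u0 := uinterval_ge0 u; have u1 := uinterval_le1 u.
have t12' : 0 < t2 - t1 by rewrite subr_gt0.
have t2' : 0 < 1 - t2 by rewrite subr_gt0.
have [ut1|t1u] := leP (set_val u) t1.
  rewrite backtrack1 ?u0// bend_le0 ?oppr_le0 ?divr_ge0 ?opprK//; last exact: ltW.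
  apply: H1; rewrite val_clamp.
    by field; rewrite gt_eqF.
  by rewrite divr_ge0 ?(ltW t1_gt0)//= ler_pdivrMr// mul1r.
have [ut2|t2u] := leP (set_val u) t2.
  rewrite backtrack2 ?(ltW t1u)// bend_le0; last first.
    by rewrite pmulr_lle0 ?invr_gt0// subr_le0.
  (* The middle piece runs along [linv y], so its parameter is the flip of the position on [y]. *)
  rewrite (H2 (uiflip (clamp (- ((set_val u - t2) / (t2 - t1)))))).
    by rewrite edge_pt_linv uiflipK.
  rewrite set_valE /= -set_valE val_clamp.
    by field; rewrite gt_eqF.
  rewrite -mulNr opprB divr_ge0 ?subr_ge0 ?(ltW t12)//= ler_pdivrMr// mul1r.
  by rewrite lerD2l lerN2 ltW.
rewrite backtrack3 ?(ltW t2u)//.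
rewrite bend_ge0; last by rewrite divr_ge0// ?subr_ge0 ltW.
apply: H3; rewrite val_clamp.
  by field; rewrite gt_eqF.
by rewrite divr_ge0 ?subr_ge0 ?(ltW t2u) ?(ltW t2_lt1)//= ler_pdivrMr// mul1r lerD2r.
Qed.

Lemma sends_edge1 f e u : sends_edge f e [:: e] -> f (edge_pt e u) = edge_pt e u.
Proof.
by move/sends_edgeP => [b [_ Hb /= Eb]]; apply: Hb; rewrite Eb; ring.
Qed.

Lemma homotopic_id_backtrack f x y :
  sends_edge f x [:: y; linv y; x] ->
  (forall z, z != x -> z != linv x -> sends_edge f z [:: z]) ->
  homotopic R f id.
Proof.
move=> /sends_edge_backtrack[t1 [t2 [t1_gt0 t12 t2_lt1 fx]]] fz.
(* Homotopies of the rose are given on positively oriented edges, while [x] may be an inverse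
   letter. *)
pose orient (u : uinterval R) := if x.2 then uiflip u else u.
have orientE u : edge_pt (x.1, false) u = edge_pt x (orient u).
  rewrite /orient; case: x {fx fz orient} => i [] //=.
  by rewrite -[RHS]edge_pt_linv.
(* The straight line from [backtrack] to the identity. Both agree at 0 and at 1, so the vertex stays
   fixed throughout. *)
pose slide (w : uinterval R * uinterval R) : R :=
  (1 - set_val w.2) * backtrack t1 t2 (set_val (orient w.1)) +
  set_val w.2 * set_val (orient w.1).
apply: (@rose_homotopic _ _ (fun i w =>
    if i == x.1 then bend x y (slide w) else edge_pt (i, false) w.1)).
- move=> i; case: eqP => _; last first.
    exact: continuous_compT (@continuous_fst _ _) (@continuous_edge_pt (i, false)).
  apply: continuous_compT (@continuous_bend x y).
  have c2 : continuous (fun w : uinterval R * uinterval R => set_val w.2).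
    exact: continuous_compT (@continuous_snd _ _) (@continuous_set_val _ _).
  have c1 : continuous (fun w : uinterval R * uinterval R => set_val (orient w.1)).
    have co : continuous orient.
      by rewrite /orient; case: x.2; [exact: continuous_uiflip|move=> u; exact: cvg_id].
    have := continuous_compT (@continuous_fst _ (uinterval R)) co.
    by move=> c; exact: continuous_compT c (@continuous_set_val _ _).
  move=> w; apply: cvgD; last by apply: cvgM; [exact: c2|exact: c1].
  apply: cvgM; first by apply: cvgB; [exact: cvg_cst|exact: c2].
  exact: (continuous_compT c1 (@continuous_backtrack t1 t2)).
- move=> i u s u01 /=; case: eqP => _; last first.
    by apply: edge_pt_end => //; rewrite /uiend eqxx.
  have : uiend (orient u) by rewrite /orient; case: ifP; rewrite ?uiend_flip.
  rewrite /slide /= => /uiendP[->|->].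
    rewrite backtrack1 ?lexx ?ltW// mul0r oppr0 !mulr0 addr0 bend_ge0//.
    by apply: edge_pt_end; rewrite ?clamp0 /uiend eqxx.
  rewrite backtrack3 ?lexx ?ltW// divff ?gt_eqF ?subr_gt0// !mulr1 subrK bend_ge0//.
  by apply: edge_pt_end; rewrite ?clamp1 /uiend eqxx ?orbT.
- move=> i u /=; case: eqP => [->|/eqP ix].
    by rewrite orientE fx /slide /= [set_val ui0]/= subr0 mul1r mul0r addr0.
  by rewrite sends_edge1//; apply: fz; apply: contraNneq ix => /(congr1 fst) /= ->.
- move=> i u /=; case: eqP => [->|//].
  rewrite orientE /slide /= [set_val ui1]/= subrr mul0r add0r mul1r.
  by rewrite bend_ge0 ?clampK// uinterval_ge0.
Qed.

End RoseHomotopy.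

(** * Composites of Nielsen graph maps *)

Section NielsenGraphMaps.
Context {R : realType} {r : nat}.
Implicit Types (th : nielsen r) (f : rose R r -> rose R r) (e : letter r).

(** The second substitution fixes y since y differs from x and x^-1, so x goes to yx and then to y
    y^-1 x. *)
Lemma nielsen_path_inverse th th' : nx th' = nx th -> ny th' = linv (ny th) ->
  nielsen_path th' (nielsen_word th (nx th)) = [:: ny th; linv (ny th); nx th].
Proof.
move=> Ex Ey; rewrite /nielsen_path /nielsen_word !eqxx /= Ex eqxx Ey.
by rewrite (negbTE (nielsen_neq th)) (negbTE (nielsen_neqV th)).
Qed.

Lemma nielsen_path_inverse_neq th th' z : nx th' = nx th ->
  z != nx th -> z != linv (nx th) ->
  nielsen_path th' (nielsen_word th z) = [:: z].
Proof.
move=> Ex /negbTE zx /negbTE zVx.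
by rewrite /nielsen_path /nielsen_word zx zVx /= Ex zx zVx.
Qed.

Lemma homotopic_nielsen_inverse th th' (f f' : rose R r -> rose R r) :
  nx th' = nx th -> ny th' = linv (ny th) ->
  nielsen_graph_map th f -> nielsen_graph_map th' f' -> homotopic R (f' \o f) id.
Proof.
move=> Ex Ey [_ fw] [_ fw'].
apply: (@homotopic_id_backtrack _ _ _ (nx th) (ny th)).
  by rewrite -(nielsen_path_inverse Ex Ey); exact: sends_edge_comp.
move=> z zx zVx.
by rewrite -(nielsen_path_inverse_neq Ex zx zVx); exact: sends_edge_comp.
Qed.

Lemma nielsen_inverse_subproof th :
  (linv (ny th) != nx th) && (linv (ny th) != linv (nx th)).
Proof.
by rewrite (can2_eq (@linvK r) (@linvK r)) (inj_eq (can_inj (@linvK r)))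
  nielsen_neq nielsen_neqV.
Qed.

Definition nielsen_inverse th : nielsen r :=
  Nielsen (proj1 (andP (nielsen_inverse_subproof th)))
    (proj2 (andP (nielsen_inverse_subproof th))).

Variable g : nielsen r -> rose R r -> rose R r.
Hypothesis gP : forall th, nielsen_graph_map th (g th).

(** The homotopy inverse is the member of the family [g] at the inverse automorphism; the same
    cancellation serves both orders. *)
Lemma homotopy_equivalence_nielsen th : homotopy_equivalence R (g th).
Proof.
have [[cg _ _] _] := gP th; have [[cg' _ _] _] := gP (nielsen_inverse th).
split=> //; exists (g (nielsen_inverse th)); split => //.
  exact: homotopic_nielsen_inverse (gP th) (gP (nielsen_inverse th)).
apply: homotopic_nielsen_inverse (gP (nielsen_inverse th)) (gP th) => //=.
by rewrite linvK.
Qed.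

(** Extracts the accumulator of the left fold, so that the first map can be split off in
    inductions. *)
Lemma comp_seq_cat ths f :
  foldl (fun f th => g th \o f) f ths = comp_seq g ths \o f.
Proof.
rewrite /comp_seq -[f in LHS]/(id \o f); elim: ths id f => //= th ths IH h f.
exact: (IH (g th \o h)).
Qed.

Lemma comp_seq_cons th ths : comp_seq g (th :: ths) = comp_seq g ths \o g th.
Proof. exact: (comp_seq_cat ths (g th)). Qed.

Lemma homotopy_equivalence_comp_seq ths :
  homotopy_equivalence R (comp_seq g ths).
Proof.
elim: ths => [|th ths IH]; first exact: homotopy_equivalence_id.
rewrite comp_seq_cons.
exact: homotopy_equivalence_comp (homotopy_equivalence_nielsen th) IH.
Qed.

Lemma sends_edge_comp_seq ths f e p : sends_edge f e p ->
  sends_edge (comp_seq g ths \o f) e (nielsen_paths ths p).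
Proof.
elim: ths f p => [//|th ths IH] f p fp.
rewrite comp_seq_cons -compA; apply: IH.
by apply: sends_edge_comp fp _ => z; have [] := gP th.
Qed.

Lemma sends_edge_iter ths k e : sends_edge (iter k (comp_seq g ths)) e
  (iter k (nielsen_paths ths) [:: e]).
Proof.
elim: k => [|k IH]; first exact: sends_edge_id.
have -> : iter k.+1 (comp_seq g ths) = comp_seq g ths \o iter k (comp_seq g ths).
  by [].
exact: sends_edge_comp_seq.
Qed.

Lemma graph_map_comp_seq ths : graph_map (comp_seq g ths).
Proof.
split.
- by have [] := homotopy_equivalence_comp_seq ths.
- elim: ths => [//|th ths IH] e; rewrite comp_seq_cons /=.
  by have [[_ -> _] _] := gP th.
- by move=> e; exists (nielsen_paths ths [:: e]); exact: (sends_edge_iter ths 1).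
Qed.

Lemma edge_path_iter ths k e :
  edge_path (iter k (comp_seq g ths)) e = iter k (nielsen_paths ths) [:: e].
Proof. exact/edge_pathE/sends_edge_iter. Qed.

Lemma Dmap_comp_seq ths : Dmap (comp_seq g ths) = nielsen_heads ths.
Proof.
apply/funext => e; rewrite /Dmap (edge_path_iter ths 1) /=.
exact: head_nielsen_paths.
Qed.

End NielsenGraphMaps.


Theorem theorem3p11 (R : realType) (r : nat) (hr : (2 <= r)%N)
    (g : nielsen r -> rose R r -> rose R r)
    (hg : forall th : nielsen r, nielsen_graph_map th (g th))
    (th1 : nielsen r) (ths : seq (nielsen r))
    (hadm : cyclically_admissible (th1 :: ths)) :
  train_track_map (comp_seq g (th1 :: ths)) /\
  forall T : {set letter r},
    (nondegenerate_turn T /\ illegal_turn (comp_seq g (th1 :: ths)) T) <->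
    T = [set nx th1; ny th1]%SET.
Proof.
set f := comp_seq g (th1 :: ths).
split.
  split; [exact: graph_map_comp_seq|exact: homotopy_equivalence_comp_seq|].
  move=> k e _; rewrite edge_path_iter//.
  exact: takes_no_illegal_turn_reduced (iter_nielsen_paths k e hadm).
move=> T; split=> [[ndT [[a [b ET]] nlT]]|->].
  move: ndT nlT; rewrite {}ET /nondegenerate_turn cards2 => ndab nlT.
  have ab : a != b by move: ndab; case: (a =P b).
  (* For distinct letters, being {x_1, y_1} amounts to being identified by the first derivative;
     otherwise all iterates keep them apart and the turn is legal. *)
  apply/eqP; move: (nielsen_head_eq th1 a b); rewrite (negbTE ab) /= => <-.
  apply: contrapT => /negP hab; apply: nlT; split.
    by rewrite /nondegenerate_turn cards2 ab.
  case=> // k _; rewrite /nondegenerate_turn imsetU1 imset_set1 cards2 Dmap_comp_seq//.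
  by rewrite iter_nielsen_heads// hab.
have xy : nx th1 != ny th1 by rewrite eq_sym nielsen_neq.
split; first by rewrite /nondegenerate_turn cards2 xy.
split; first by exists (nx th1), (ny th1).
(* The turn {x_1, y_1} already degenerates at the first iterate. *)
move=> [_ /(_ 1%N erefl)].
rewrite /nondegenerate_turn imsetU1 imset_set1 cards2 Dmap_comp_seq//.
by rewrite (iter_nielsen_heads 0)// nielsen_head_eq eqxx orbT.
Qed.
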